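(* Let $H$ be a Hilbert space over $\mathbb{R}$ or $\mathbb{C}$, let $[a,b]$ be a compact real interval, and let $\Delta := \{(t,s)\in\mathbb{R}^2 : a\le t\le s\le b\}$. Let $f\in L([a,b];H)$ be such that there exists a function $k:\Delta\to\mathbb{R}$ with $k\in L(\Delta)$ and $$(0\le)\ \|f(t)\|\,\|f(s)\| - \operatorname{Re}\langle f(t),f(s)\rangle \le k(t,s)\quad\text{for a.e. }(t,s)\in\Delta. \qquad ( * )$$ Then $$\left(\int_a^b \|f(t)\|\,dt\right)^2 \le \left\|\int_a^b f(t)\,dt\right\|^2 + 2\iint_\Delta k(t,s)\,dt\,ds. \qquad ( ** )$$ Equality holds in $( ** )$ if and only if equality holds in $( * )$, i.e. $\|f(t)\|\,\|f(s)\| - \operatorname{Re}\langle f(t),f(s)\rangle = k(t,s)$, for a.e. $(t,s)\in\Delta$.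
   Context: $L([a,b];H)$ denotes the space of Bochner integrable functions on $[a,b]$ (with Lebesgue measure) with values in the Hilbert space $H$. $L(\Delta)$ denotes the space of Lebesgue integrable real-valued functions on $\Delta$ (with two-dimensional Lebesgue measure). $\langle\cdot,\cdot\rangle$ is the inner product of $H$ and $\|\cdot\|$ its norm. The parenthetical ''$(0\le)$'' records that the left-hand quantity is automatically nonnegative by the Schwarz inequality; it is not an extra hypothesis. *)

(* Defs.v *)
From HB Require Import structures.
From mathcomp Require Import all_boot all_order all_algebra.
From mathcomp Require Import sesquilinear complex.
From mathcomp Require Import all_classical all_reals all_analysis.

Set Implicit Arguments.
Unset Strict Implicit.
Unset Printing Implicit Defensive.

Import Order.TTheory GRing.Theory Num.Theory.
Import numFieldNormedType.Exports.

Local Open Scope classical_set_scope.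
Local Open Scope ring_scope.

Variant scalar_kind := RealScalars | ComplexScalars.

Definition scalars (R : realType) (c : scalar_kind) : numFieldType :=
  match c with
  | RealScalars => (R : numFieldType)
  | ComplexScalars => (R[i] : numFieldType)
  end.

Definition scalar_of_real {R : realType} {c : scalar_kind} :
    R -> scalars R c :=
  match c return R -> scalars R c with
  | RealScalars => id
  | ComplexScalars => real_complex R
  end.

Definition scalar_Re {R : realType} {c : scalar_kind} : scalars R c -> R :=
  match c return scalars R c -> R with
  | RealScalars => id
  | ComplexScalars => @complex.Re R
  end.

Definition scalar_conj {R : realType} {c : scalar_kind} :
    scalars R c -> scalars R c :=
  match c return scalars R c -> scalars R c with
  | RealScalars => id
  | ComplexScalars => @Num.conj R[i]
  end.

Section Bochner.
Local Open Scope ereal_scope.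
Context {R : realType} {c : scalar_kind} {H : normedModType (scalars R c)}.

(* The library's norm on [H] takes its values in the scalar field. *)
Definition rnorm (x : H) : R := scalar_Re `|x|%R.

Context d (T : measurableType d) (mu : {measure set T -> \bar R}).
Implicit Types (D : set T) (f s : T -> H).

Definition simple_on D s :=
  [/\ finite_set (s @` D),
      forall v, measurable (D `&` s @^-1` [set v]) &
      forall v, v != 0%R -> mu (D `&` s @^-1` [set v]) < +oo].

Definition simple_integral D s : H :=
  (\sum_(v \in s @` D)
     scalar_of_real (fine (mu (D `&` s @^-1` [set v]))) *: v)%R.

Definition bochner_approx D f (s : nat -> T -> H) :=
  [/\ forall n, simple_on D (s n),
      {ae mu, forall x, D x -> s n x @[n --> \oo] --> f x} &
      \int[mu]_(x in D) (rnorm (f x - s n x))%:E @[n --> \oo] --> 0].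

Definition bochner_integrable D f :=
  exists s : nat -> T -> H, bochner_approx D f s.

(* The limit depends neither on the approximating sequence nor on values of [f]
   outside [D]; the value is the default point of [H] when [f] is not
   integrable. *)
Definition bochner_integral D f : H :=
  get [set v | exists s : nat -> T -> H, bochner_approx D f s /\
                 simple_integral D (s n) @[n --> \oo] --> v].

End Bochner.

(* The library's product measure lives on the Borel sets of the plane; its
   completion is the two-dimensional Lebesgue measure. *)
Definition planar_lebesgue_measure {R : realType} : set _ -> \bar R :=
  @completed_measure_extension _ _ _
    (@lebesgue_measure R \x @lebesgue_measure R)%E.
HB.instance Definition _ (R : realType) :=
  Measure.on (@planar_lebesgue_measure R).

Definition triangle {R : realType} (a b : R) : set (R * R) :=
  [set z | [/\ a <= z.1, z.1 <= z.2 & z.2 <= b]].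

(* Main.v *)
(* With [g(t,s) = ||f t|| ||f s|| - Re <f t, f s>], Tonelli gives that the
   integral of [g] over the square is [(\int ||f||)^2 - ||\int f||^2]; as [g] is
   symmetric and the diagonal is null, the triangle carries half of it.  What
   remains is the monotonicity of the integral, with its equality case, for
   [g <= k] on the triangle.  The Bochner integral enters only through its weak
   characterization [Re <\int f, x> = \int Re <f t, x>], which also provides its
   existence: with [x = V n - V m], it bounds [||V n - V m||] for the integrals
   [V n] of the approximating simple functions. *)
Require Import Defs.
From mathcomp Require Import all_boot all_order all_algebra.
From mathcomp Require Import sesquilinear complex.
From mathcomp Require Import all_classical all_reals all_analysis.
From mathcomp Require Import finmap measurable_realfun ring lra.
Import Order.TTheory GRing.Theory Num.Theory.
Import numFieldNormedType.Exports.
Set Implicit Arguments.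
Unset Strict Implicit.
Unset Printing Implicit Defensive.
Local Open Scope classical_set_scope.
Local Open Scope ring_scope.

(** * Real and complex scalars treated alike *)

Section scalars.
Context {R : realType} {c : scalar_kind}.
Implicit Types (r : R) (z : scalars R c).

Lemma scalar_of_real_le r1 r2 :
  (scalar_of_real r1 <= scalar_of_real r2 :> scalars R c) = (r1 <= r2).
Proof. by case: c => //=; rewrite lecR. Qed.

Lemma scalar_of_real_lt r1 r2 :
  (scalar_of_real r1 < scalar_of_real r2 :> scalars R c) = (r1 < r2).
Proof. by case: c => //=; rewrite ltcR. Qed.

Lemma scalar_of_realD r1 r2 : scalar_of_real (r1 + r2) =
  scalar_of_real r1 + scalar_of_real r2 :> scalars R c.
Proof. by case: c => //=; rewrite rmorphD. Qed.

Lemma scalar_of_real0 : scalar_of_real 0 = 0 :> scalars R c.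
Proof. by case: c. Qed.

Lemma scalar_ReK r : scalar_Re (scalar_of_real r : scalars R c) = r.
Proof. by case: c. Qed.

Lemma scalar_Re_ge0K z : 0 <= z -> scalar_of_real (scalar_Re z) = z.
Proof. by case: c z => //= z /ger0_real /Creal_ReP; rewrite /=complexRe. Qed.

Lemma scalar_ReD z1 z2 : scalar_Re (z1 + z2) = scalar_Re z1 + scalar_Re z2.
Proof. by case: c z1 z2 => //= z1 z2; rewrite raddfD. Qed.

Lemma scalar_ReN z : scalar_Re (- z) = - scalar_Re z.
Proof. by case: c z => //= z; rewrite raddfN. Qed.

Lemma scalar_ReZ r z : scalar_Re (scalar_of_real r * z) = r * scalar_Re z.
Proof. by case: c z => //= -[x y] /=; rewrite mul0r subr0. Qed.

Lemma scalar_Re_conj z : scalar_Re (scalar_conj z) = scalar_Re z.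
Proof. by case: c z => //= -[]. Qed.

End scalars.

(** * The real-valued norm and convergence in it *)

Section rnorm.
Context {R : realType} {c : scalar_kind} {H : normedModType (scalars R c)}.
Implicit Types (r : R) (x y : H).

Lemma scalar_of_real_rnorm x : scalar_of_real (rnorm x) = `|x|.
Proof. by rewrite /rnorm scalar_Re_ge0K. Qed.

Lemma rnorm_ge0 x : 0 <= rnorm x.
Proof.
by rewrite -(@scalar_of_real_le _ c) scalar_of_real_rnorm scalar_of_real0.
Qed.

Lemma rnormD x y : rnorm (x + y) <= rnorm x + rnorm y.
Proof.
rewrite -(@scalar_of_real_le _ c) scalar_of_realD !scalar_of_real_rnorm.
exact: ler_normD.
Qed.

Lemma rnormN x : rnorm (- x) = rnorm x.
Proof. by rewrite /rnorm normrN. Qed.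

Lemma rnorm_eq0 x : rnorm x = 0 -> x = 0.
Proof.
move=> x0; apply/normr0_eq0.
by rewrite -scalar_of_real_rnorm x0 scalar_of_real0.
Qed.

Lemma rnormBC x y : rnorm (x - y) = rnorm (y - x).
Proof. by rewrite -rnormN opprB. Qed.

Lemma ler_rnormB_dist x y : `|rnorm x - rnorm y| <= rnorm (x - y).
Proof.
rewrite ler_norml; apply/andP; split.
  rewrite lerNl opprB lerBlDr rnormBC.
  by apply: le_trans (rnormD _ _); rewrite subrK.
by rewrite lerBlDr; apply: le_trans (rnormD _ _); rewrite subrK.
Qed.

(** Balls of [H] have radii in the scalar field; a positive radius is real even in [R[i]], so it
    passes to [R] by [scalar_Re] and back by [scalar_of_real]. *)
Lemma cvg_rnormP (u : nat -> H) x :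
  (u n @[n --> \oo] --> x) <-> (rnorm (u n - x) @[n --> \oo] --> (0 : R)).
Proof.
split => [/cvgrPdist_lt ux|/cvgrPdist_lt ux].
  apply/cvgrPdist_lt => e e0.
  have e0' : 0 < scalar_of_real e :> scalars R c.
    by rewrite -scalar_of_real0 scalar_of_real_lt.
  apply: filterS (ux _ e0') => n.
  rewrite -scalar_of_real_rnorm scalar_of_real_lt sub0r normrN.
  by rewrite ger0_norm ?rnorm_ge0// rnormBC.
apply/cvgrPdist_lt => e e0.
have e0' : 0 < scalar_Re e.
  by rewrite -(@scalar_of_real_lt _ c) scalar_Re_ge0K ?scalar_of_real0// ltW.
apply: filterS (ux _ e0') => n.
rewrite sub0r normrN ger0_norm ?rnorm_ge0// -(@scalar_of_real_lt _ c).
by rewrite scalar_of_real_rnorm scalar_Re_ge0K 1?ltW// distrC.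
Qed.

End rnorm.

Lemma rnorm_cauchy_cvg {R : realType} {c : scalar_kind}
    {H : completeNormedModType (scalars R c)} (u : nat -> H) (e : nat -> R) :
  (forall n m, rnorm (u n - u m) <= e n + e m) ->
  e n @[n --> \oo] --> (0 : R) -> cvg (u n @[n --> \oo]).
Proof.
move=> ue /cvgrPdist_lt e0.
apply/cauchy_cvgP/cauchy_ballP => eps eps0.
have eps0' : 0 < scalar_Re eps.
  by rewrite -(@scalar_of_real_lt _ c) scalar_Re_ge0K ?scalar_of_real0// ltW.
have /e0 [N _ HN] : 0 < scalar_Re eps / 2 by rewrite divr_gt0.
exists (u @` [set n | (N <= n)%N], u @` [set n | (N <= n)%N]).
  by split; exists N => // n /= Nn; exists n.
move=> [_ _] /= [[n Nn <-] [m Nm <-]].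
rewrite -ball_normE /ball_/= -scalar_of_real_rnorm -(scalar_Re_ge0K (ltW eps0)).
rewrite scalar_of_real_lt; apply: le_lt_trans (ue _ _) _.
rewrite (splitr (scalar_Re eps)).
move: (HN _ Nn) (HN _ Nm) => /=; rewrite !sub0r !normrN => h1 h2.
by rewrite ltrD// (le_lt_trans (ler_norm _)).
Qed.

Lemma norm_le_cvg0 {R : realType} (a b : nat -> R) :
  (forall n, `|a n| <= b n) -> b n @[n --> \oo] --> (0 : R) ->
  a n @[n --> \oo] --> (0 : R).
Proof.
move=> ab b0; apply/norm_cvg0P.
apply: (@squeeze_cvgr _ _ _ _ (fun=> 0) b) => //.
  by apply: nearW => n; rewrite normr_ge0 ab.
exact: cvg_cst.
Qed.

Lemma dist_le_cvg {R : realType} (a b : nat -> R) l :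
  (forall n, `|a n - l| <= b n) -> b n @[n --> \oo] --> (0 : R) ->
  a n @[n --> \oo] --> l.
Proof.
move=> ab b0; rewrite (_ : (fun n => a n) = (fun n => (a n - l) + l)).
  rewrite -[X in _ --> X]add0r; apply: cvgD; last exact: cvg_cst.
  exact: norm_le_cvg0 b0.
by apply/funext => n; rewrite subrK.
Qed.

(** * The real part of the inner product and the Schwarz inequality *)

Section rdot.
Context {R : realType} {c : scalar_kind} {H : normedModType (scalars R c)}.
Variable dot : {dot H for scalar_conj}.
Hypothesis dot_norm : forall x : H, dot x x = `|x| ^+ 2.
Implicit Types (r : R) (x y z : H).

(** The real inner product underlying [dot]: symmetric and real bilinear for both kinds of scalars,
    so one argument serves both. *)
Definition rdot x y : R := scalar_Re (dot x y).

Lemma rdotDl x y z : rdot (x + y) z = rdot x z + rdot y z.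
Proof. by rewrite /rdot linearDl scalar_ReD. Qed.

Lemma rdotNl x z : rdot (- x) z = - rdot x z.
Proof. by rewrite /rdot linearNl scalar_ReN. Qed.

Lemma rdotBl x y z : rdot (x - y) z = rdot x z - rdot y z.
Proof. by rewrite rdotDl rdotNl. Qed.

Lemma rdotZl r x z : rdot (scalar_of_real r *: x) z = r * rdot x z.
Proof. by rewrite /rdot linearZl_LR scalar_ReZ. Qed.

Lemma rdotC x y : rdot x y = rdot y x.
Proof.
by rewrite /rdot (@hermitian_subproof _ _ _ _ dot) expr0 mul1r scalar_Re_conj.
Qed.

Lemma rdotxx x : rdot x x = rnorm x ^+ 2.
Proof.
by rewrite /rdot dot_norm -scalar_of_real_rnorm expr2 scalar_ReZ scalar_ReK.
Qed.

Lemma rdot0l x : rdot 0 x = 0.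
Proof. by rewrite -(subrr 0) rdotBl subrr. Qed.

Lemma rdotBr x y z : rdot x (y - z) = rdot x y - rdot x z.
Proof. by rewrite rdotC rdotBl !(rdotC _ x). Qed.

Lemma rdotZr r x z : rdot z (scalar_of_real r *: x) = r * rdot z x.
Proof. by rewrite rdotC rdotZl rdotC. Qed.

(** With z = ||y|| x - ||x|| y, expanding 0 <= [rdot z z] gives 0 <= 2 ||x|| ||y|| (||x|| ||y|| -
    [rdot x y]), where the product of the norms divides out unless a vector is zero. *)
Lemma ler_rdot x y : rdot x y <= rnorm x * rnorm y.
Proof.
have [/eqP xy0|xy0] := boolP (rnorm x * rnorm y == 0).
  rewrite xy0; move/eqP : xy0; rewrite mulf_eq0 => /orP[] /eqP/rnorm_eq0 ->.
    by rewrite rdot0l.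
  by rewrite rdotC rdot0l.
have {}xy0 : 0 < rnorm x * rnorm y by rewrite lt0r xy0 mulr_ge0// rnorm_ge0.
set z := scalar_of_real (rnorm y) *: x - scalar_of_real (rnorm x) *: y.
have : 0 <= rdot z z by rewrite rdotxx sqr_ge0.
rewrite rdotBl !rdotZl !rdotBr !rdotZr !rdotxx (rdotC y x) => z0.
have : 0 <= (rnorm x * rnorm y) * (rnorm x * rnorm y - rdot x y) by lra.
by rewrite pmulr_rge0// subr_ge0.
Qed.

Lemma ler_norm_rdot x y : `|rdot x y| <= rnorm x * rnorm y.
Proof.
rewrite ler_norml ler_rdot andbT lerNl -rdotNl.
by rewrite -[rnorm x]rnormN ler_rdot.
Qed.

Lemma cvg_rdot (u v : nat -> H) x y :
  u n @[n --> \oo] --> x -> v n @[n --> \oo] --> y ->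
  rdot (u n) (v n) @[n --> \oo] --> rdot x y.
Proof.
move=> /cvg_rnormP ux /cvg_rnormP vy.
(* Expansion around the limit: each term with a difference is bounded by the Schwarz inequality and
   tends to 0. *)
rewrite (_ : (fun n => _) = (fun n => rdot (u n - x) (v n - y)
    + rdot (u n - x) y + rdot x (v n - y) + rdot x y)); last first.
  by apply/funext => n; rewrite !(rdotBl, rdotBr); ring.
rewrite -[X in _ --> X]add0r; apply: cvgD; last exact: cvg_cst.
rewrite -[X in _ --> X]add0r; apply: cvgD; last first.
  apply: (norm_le_cvg0 (fun n => ler_norm_rdot _ _)).
  by rewrite -(mulr0 (rnorm x)); apply: cvgMr.
rewrite -[X in _ --> X]add0r; apply: cvgD.
  apply: (norm_le_cvg0 (fun n => ler_norm_rdot _ _)).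
  by rewrite -(mulr0 0); apply: cvgM.
apply: (norm_le_cvg0 (fun n => ler_norm_rdot _ _)).
by rewrite -(mul0r (rnorm y)); apply: cvgMl.
Qed.

End rdot.

(** * Simple functions: measurability and integrals *)

(** A preimage is a finite union of level sets, so [F] may be arbitrary. Real expressions in
    vector-valued simple functions thus become measurable without a sigma-algebra on the vectors. *)
Lemma finite_image_measurable_fun d (T : measurableType d) (V : Type)
    d' (U : measurableType d') (D : set T) (g : T -> V) (F : V -> U) :
  finite_set (g @` D) -> (forall v, measurable (D `&` g @^-1` [set v])) ->
  measurable_fun D (fun t => F (g t)).
Proof.
move=> fg mg _ Y mY; rewrite (_ : _ `&` _ =
    \bigcup_(v in g @` D `&` F @^-1` Y) (D `&` g @^-1` [set v])); last first.
  apply/seteqP; split=> [t [Dt Yt]|t [v [_ Yv] [Dt /= stv]]]; last first.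
    by split=> //=; rewrite stv.
  by exists (g t) => //; split=> //; exists t.
by apply: fin_bigcup_measurable => //; exact: finite_setIl.
Qed.

Section simple_on.
Context {R : realType} {c : scalar_kind} {H : normedModType (scalars R c)}.
Context d (T : measurableType d) (mu : {measure set T -> \bar R}).
Implicit Types (D : set T) (s : T -> H).

Lemma simple_on_measurable_fun D s d' (U : measurableType d') (F : H -> U) :
  simple_on mu D s -> measurable_fun D (fun t => F (s t)).
Proof. by case=> fs ms _; exact: finite_image_measurable_fun. Qed.

Lemma simple_on_measurable_fun2 D s1 s2 d' (U : measurableType d')
    (F : H -> H -> U) :
  simple_on mu D s1 -> simple_on mu D s2 ->
  measurable_fun D (fun t => F (s1 t) (s2 t)).
Proof.
case=> fs1 ms1 _ [fs2 ms2 _].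
apply: (@finite_image_measurable_fun _ _ _ _ _ D (fun t => (s1 t, s2 t))
  (fun v => F v.1 v.2)).
  apply: sub_finite_set (finite_setX fs1 fs2) => _ [t Dt <-].
  by split; exists t.
move=> [v w]; rewrite (_ : _ `&` _ =
    (D `&` s1 @^-1` [set v]) `&` (D `&` s2 @^-1` [set w])); last first.
  by apply/seteqP; split=> [t [Dt [<- <-]]|t [[Dt <-] [_ <-]]].
exact: measurableI.
Qed.

Lemma simple_on_measurable_funX D s1 s2 d' (U : measurableType d')
    (F : H -> H -> U) :
  simple_on mu D s1 -> simple_on mu D s2 ->
  measurable_fun (D `*` D) (fun z : T * T => F (s1 z.1) (s2 z.2)).
Proof.
case=> fs1 ms1 _ [fs2 ms2 _].
apply: (@finite_image_measurable_fun _ _ _ _ _ (D `*` D)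
  (fun z => (s1 z.1, s2 z.2)) (fun v => F v.1 v.2)).
  apply: sub_finite_set (finite_setX fs1 fs2) => _ [z [Dz1 Dz2] <-].
  by split; [exists z.1|exists z.2].
move=> [v w]; rewrite (_ : _ `&` _ =
    (D `&` s1 @^-1` [set v]) `*` (D `&` s2 @^-1` [set w])); last first.
  by apply/seteqP; split=> [z [[? ?] [<- <-]]|z [[? <-] [? <-]]].
exact: measurableX.
Qed.

(** On [D], [h \o s] is the sum of the [h v] times the indicators of the level sets. As [h] may not
    vanish at 0, the level set of 0 counts too; its measure is finite because that of [D] is. *)
Lemma simple_on_integral D s (h : H -> R) : measurable D -> (mu D < +oo)%E ->
  simple_on mu D s ->
  mu.-integrable D (EFin \o (h \o s)) /\
  \int[mu]_(t in D) h (s t) =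
  \sum_(v <- fset_set (s @` D)) h v * fine (mu (D `&` s @^-1` [set v])).
Proof.
move=> mD Doo ss; have [fs ms _] := ss.
pose A v := D `&` s @^-1` [set v].
have mA v : measurable (A v) by exact: ms.
have Aoo v : (mu (A v) < +oo)%E.
  apply: le_lt_trans Doo; apply: le_measure;
    [exact/mem_set|exact/mem_set|exact: subIsetl].
have hsE t : D t -> (h (s t))%:E =
    (\sum_(v <- fset_set (s @` D)) (h v)%:E * (\1_(A v) t)%:E)%E.
  move=> Dt; rewrite (big_fsetD1 (s t))/=; last first.
    by rewrite in_fset_set//; apply/mem_set; exists t.
  rewrite big_seq big1 ?adde0.
    by rewrite indicE mem_set ?mule1//; split.
  move=> v; rewrite !inE => /andP[vst _].
  by rewrite indicE memNset ?mule0// => -[_ /= /esym/eqP]; exact/negP.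
have indA v : mu.-integrable D (fun t => (\1_(A v) t)%:E)%E.
  apply/integrableP; split.
    exact/measurable_EFinP/measurable_indic.
  under eq_integral do rewrite gee0_abs ?lee_fin//.
  rewrite integral_indic//; apply: le_lt_trans Doo.
  by apply: le_measure;
    [exact/mem_set/measurableI|exact/mem_set|exact: subIsetl].
have iA v : mu.-integrable D (fun t => (h v)%:E * (\1_(A v) t)%:E)%E.
  exact: integrableZl.
split.
  apply: (eq_integrable _ (fun t =>
      \sum_(v <- fset_set (s @` D)) (h v)%:E * (\1_(A v) t)%:E)%E) => //.
    by move=> t /set_mem Dt; rewrite -hsE.
  by apply: integrable_sum.
rewrite /Rintegral (eq_integral (fun t =>
    \sum_(v <- fset_set (s @` D)) (h v)%:E * (\1_(A v) t)%:E)%E); last first.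
  by move=> t /set_mem; exact: hsE.
rewrite integral_sum// -sum_fine; last first.
  by move=> v _; exact: integrable_fin_num.
apply: eq_bigr => v _; rewrite integralZl//.
rewrite integral_indic// (_ : A v `&` D = A v); last first.
  by rewrite setIC /A setIA setIid.
by rewrite fineM// ge0_fin_numE.
Qed.

Variable dot : {dot H for scalar_conj}.

(** The weak characterization for simple functions: both sides are the same finite sum over the
    values of [s]. *)
Lemma rdot_simple_integral D s x : measurable D -> (mu D < +oo)%E ->
  simple_on mu D s ->
  rdot dot (simple_integral mu D s) x = \int[mu]_(t in D) rdot dot (s t) x.
Proof.
move=> mD Doo ss; have [_ ->] := simple_on_integral (rdot dot ^~ x) mD Doo ss.
rewrite /simple_integral fsbig_finite; last by case: ss.
rewrite (big_morph (rdot dot ^~ x) (fun y z => rdotDl dot y z x)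
  (rdot0l dot x)).
by apply: eq_bigr => v _; rewrite rdotZl mulrC.
Qed.

End simple_on.

Lemma simple_onS {R : realType} {c : scalar_kind}
    {H : normedModType (scalars R c)} d (T : measurableType d)
    (mu : {measure set T -> \bar R}) (D E : set T) (s : T -> H) :
  measurable E -> E `<=` D -> simple_on mu D s -> simple_on mu E s.
Proof.
move=> mE ED [fs ms soo].
have mEs v : measurable (E `&` s @^-1` [set v]).
  rewrite (_ : _ `&` _ = E `&` (D `&` s @^-1` [set v])).
    exact: measurableI.
  by rewrite setIA; congr (_ `&` _); apply/esym/setIidl.
split=> // [|v /soo]; first by apply: sub_finite_set fs; exact: image_subset.
by apply: le_lt_trans; apply: le_measure;
  [exact/mem_set|exact/mem_set|exact: setSI].
Qed.

Lemma dominated_integrable {R : realType} d (T : measurableType d)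
    (mu : {measure set T -> \bar R}) (D : set T) (g h : T -> R) :
  measurable D -> measurable_fun D g ->
  (forall t, D t -> `|g t| <= h t) ->
  mu.-integrable D (fun t => (h t)%:E) -> mu.-integrable D (fun t => (g t)%:E).
Proof.
move=> mD mg gh; apply: le_integrable => //; first exact/measurable_EFinP.
move=> t Dt; rewrite !abse_EFin lee_fin.
by apply: le_trans (gh _ Dt) _; exact: ler_norm.
Qed.

(** * Everywhere limits of simple functions and their weak integrals *)

Section strong_approx.
Context {R : realType} {c : scalar_kind} {H : normedModType (scalars R c)}.
Context d (T : measurableType d) (mu : {measure set T -> \bar R}).
Variables (D : set T) (f : T -> H) (s : nat -> T -> H).
Hypotheses (mD : measurable D) (Doo : (mu D < +oo)%E).
Hypothesis ss : forall n, simple_on mu D (s n).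
Hypothesis sf : forall t, D t -> s n t @[n --> \oo] --> f t.
Hypothesis intsf :
  (\int[mu]_(t in D) (rnorm (f t - s n t))%:E @[n --> \oo] --> 0)%E.

Lemma cvg_rnorm_approx t : D t -> rnorm (s n t) @[n --> \oo] --> rnorm (f t).
Proof.
by move=> /sf /cvg_rnormP; apply: dist_le_cvg => n; exact: ler_rnormB_dist.
Qed.

Lemma measurable_rnorm_limit : measurable_fun D (fun t => rnorm (f t)).
Proof.
apply: (measurable_fun_cvg (h := fun n t => rnorm (s n t))) => [n|t].
  exact: simple_on_measurable_fun (@rnorm R c H) (ss n).
exact: cvg_rnorm_approx.
Qed.

Lemma measurable_rnorm_limitB n :
  measurable_fun D (fun t => rnorm (f t - s n t)).
Proof.
apply: (measurable_fun_cvg (h := fun m t => rnorm (s m t - s n t))) => [m|t Dt].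
  exact: simple_on_measurable_fun2 (fun x y => rnorm (x - y)) (ss m) (ss n).
apply: dist_le_cvg ((cvg_rnormP _ _).1 (sf Dt)) => k.
by apply: le_trans (ler_rnormB_dist _ _) _; rewrite opprB addrA subrK.
Qed.

Lemma integrable_rnorm_limit : mu.-integrable D (fun t => (rnorm (f t))%:E).
Proof.
(* Convergence to 0 in the extended reals makes the integrals eventually finite; [N] is an index
   from which they are. *)
have /fine_cvgP[[N _ intf] _] := intsf.
apply: (@dominated_integrable _ _ _ _ _ _
  (fun t => rnorm (f t - s N t) + rnorm (s N t))) => //.
- exact: measurable_rnorm_limit.
- move=> t _; rewrite ger0_norm ?rnorm_ge0//.
  by apply: le_trans (rnormD _ _); rewrite subrK.
- have isN : mu.-integrable D (fun t => (rnorm (f t - s N t))%:E).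
    apply/integrableP; split.
      exact/measurable_EFinP/measurable_rnorm_limitB.
    under eq_integral do rewrite gee0_abs ?lee_fin ?rnorm_ge0//.
    rewrite -ge0_fin_numE; first exact: (intf N (leqnn N)).
    by apply: integral_ge0 => t _; rewrite lee_fin rnorm_ge0.
  have [isN' _] := simple_on_integral (@rnorm R c H) mD Doo (ss N).
  exact: (integrableD mD isN isN').
Qed.

Lemma integrable_rnorm_limitB n :
  mu.-integrable D (fun t => (rnorm (f t - s n t))%:E).
Proof.
apply: (@dominated_integrable _ _ _ _ _ _
  (fun t => rnorm (f t) + rnorm (s n t))) => //.
- exact: measurable_rnorm_limitB.
- move=> t _; rewrite ger0_norm ?rnorm_ge0//.
  by apply: le_trans (rnormD _ _) _; rewrite rnormN.
- have [isn _] := simple_on_integral (@rnorm R c H) mD Doo (ss n).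
  exact: (integrableD mD integrable_rnorm_limit isn).
Qed.

Let e n : R := \int[mu]_(t in D) rnorm (f t - s n t).

Lemma cvg_approx_error : e n @[n --> \oo] --> (0 : R).
Proof.
by have /fine_cvg := intsf.
Qed.

Variable dot : {dot H for scalar_conj}.
Hypothesis dot_norm : forall x : H, dot x x = `|x| ^+ 2.
Notation rdot := (rdot dot).

Lemma measurable_rdot_limit x : measurable_fun D (fun t => rdot (f t) x).
Proof.
apply: (measurable_fun_cvg (h := fun n t => rdot (s n t) x)) => [n|t Dt].
  exact: simple_on_measurable_fun (rdot ^~ x) (ss n).
by apply: cvg_rdot => //; [exact: sf|exact: cvg_cst].
Qed.

Lemma integrable_rdot_limit x :
  mu.-integrable D (fun t => (rdot (f t) x)%:E).
Proof.
apply: (@dominated_integrable _ _ _ _ _ _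
  (fun t => rnorm (f t) * rnorm x)) => //.
- exact/measurable_rdot_limit.
- by move=> t _; exact: ler_norm_rdot.
- exact: (integrableZr mD (rnorm x) integrable_rnorm_limit).
Qed.

Lemma integrable_rdot_simple n x :
  mu.-integrable D (fun t => (rdot (s n t) x)%:E).
Proof. by have [] := simple_on_integral (rdot ^~ x) mD Doo (ss n). Qed.

(** The Schwarz inequality under the integral turns the L1 error into a weak error, with [x]
    entering through its norm only. *)
Lemma rdot_approx_error n x :
  `|\int[mu]_(t in D) rdot (f t) x - \int[mu]_(t in D) rdot (s n t) x|
    <= e n * rnorm x.
Proof.
have ifs :=
  integrableB mD (integrable_rdot_limit x) (integrable_rdot_simple n x).
rewrite -RintegralB//; first last.
- exact: integrable_rdot_simple.
- exact: integrable_rdot_limit.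
apply: le_trans (le_normr_Rintegral mD ifs) _.
rewrite -RintegralZr//; last exact: integrable_rnorm_limitB.
apply: le_Rintegral => //.
- exact: (integrable_norm ifs).
- exact: (integrableZr mD (rnorm x) (integrable_rnorm_limitB n)).
- by move=> t _; rewrite -rdotBl ler_norm_rdot.
Qed.

Variable V : nat -> H.
Hypothesis VE : forall n x, rdot (V n) x = \int[mu]_(t in D) rdot (s n t) x.

(** Pairing V n - V m with itself and inserting the integral of [f] between those of [s n] and [s m]
    gives ||V n - V m||^2 <= (e n + e m) ||V n - V m||. The vectors enter through [VE] only, because
    they will be simple integrals over a domain larger by a null set. *)
Lemma weak_integral_cauchy n m : rnorm (V n - V m) <= e n + e m.
Proof.
have [->|V0] := eqVneq (rnorm (V n - V m)) 0.
  by rewrite addr_ge0// Rintegral_ge0// => t _; exact: rnorm_ge0.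
have {}V0 : 0 < rnorm (V n - V m) by rewrite lt0r V0 rnorm_ge0.
rewrite -(ler_pM2r V0) -expr2 -(rdotxx dot_norm) rdotBl !VE mulrDl.
set x := V n - V m.
have := rdot_approx_error n x; have := rdot_approx_error m x.
by rewrite !ler_norml; lra.
Qed.

Lemma rdot_weak_integral v x : V n @[n --> \oo] --> v ->
  rdot v x = \int[mu]_(t in D) rdot (f t) x.
Proof.
move=> Vv; have Vvx : rdot (V n) x @[n --> \oo] --> rdot v x.
  by apply: cvg_rdot => //; exact: cvg_cst.
apply: cvg_unique Vvx _ => //.
apply: (@dist_le_cvg _ _ (fun n => e n * rnorm x)).
  by move=> n; rewrite VE distrC rdot_approx_error.
rewrite -(mul0r (rnorm x)); apply: cvgMl; exact: cvg_approx_error.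
Qed.

End strong_approx.

(** * Transport of a product measure along a map *)

Section product_measure_transfer.
Context {R : realType} d (T : measurableType d) d' (U : measurableType d').
Variables (m : {sigma_finite_measure set T -> \bar R}).
Variables (n : {measure set U -> \bar R}) (phi : U -> T * T).
Hypothesis mphi : measurable_fun setT phi.
Hypothesis nE : forall A B : set T, measurable A -> measurable B ->
  n (phi @^-1` (A `*` B)) = (m A * m B)%E.

(** The pushforward of [n] under [phi] agrees with the product measure on rectangles by [nE], so
    uniqueness of the product measure applies. *)
Lemma product_measure_preimage (X : set (T * T)) :
  measurable X -> n (phi @^-1` X) = (m \x m)%E X.
Proof.
move=> mX; apply/esym.
exact: (product_measure_unique (m' := pushforward n phi)).
Qed.

Lemma product_measure_integral (g : T * T -> \bar R) :
  measurable_fun setT g -> (forall z, 0 <= g z)%E ->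
  (\int[n]_z g (phi z) = \int[m \x m]_z g z)%E.
Proof.
move=> mg g0; transitivity (\int[pushforward n phi]_z g z)%E.
  by rewrite (ge0_integral_pushforward mphi).
by apply: eq_measure_integral => X mX _; exact: product_measure_preimage.
Qed.

End product_measure_transfer.

(** * Planar Lebesgue measure and the product of the completed lines *)

Section planar.
Context {R : realType}.
Local Open Scope ereal_scope.

Let T0 : measurableType _ := measurableTypeR R.
Let T1 : measurableType _ := caratheodory_type (@wlength R idfun)^*%mu.
Let T2 : measurableType _ :=
  caratheodory_type (@lebesgue_measure R \x @lebesgue_measure R)^*%mu.
Let leb : {measure set T0 -> \bar R} := @lebesgue_measure R.
Let cleb : {measure set T1 -> \bar R} := @completed_lebesgue_measure R.
Let pleb : {measure set T2 -> \bar R} := @planar_lebesgue_measure R.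

(** Caratheodory measurable sets form the completion of the Borel sigma-algebra: each is a Borel set
    together with a subset of a Borel null set. *)
Lemma completed_lebesgue_decomp (A : set R) : @measurable _ T1 A ->
  exists X Z : set R, [/\ @measurable _ T0 X, @measurable _ T0 Z,
    leb Z = 0, X `<=` A & A `<=` X `|` Z].
Proof.
rewrite -[X in X A -> _]completed_caratheodory_measurable.
rewrite g_sigma_completed_algebra_genE => -[X mX [N [Z [mZ Z0 NZ]]]] <-.
by exists X, Z; split=> //; exact: setUS.
Qed.

Lemma completed_lebesgue_borel (X : set R) : @measurable _ T0 X ->
  @measurable _ T1 X /\ cleb X = leb X.
Proof. by move=> mX; split => //; exact: sub_caratheodory. Qed.

Lemma planar_lebesgue_borel (X : set (R * R)) :
  @measurable _ (T0 * T0)%type X ->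
  @measurable _ T2 X /\ pleb X = (lebesgue_measure \x lebesgue_measure) X.
Proof.
move=> mX; split; first by apply: sub_caratheodory; exact: sub_sigma_algebra.
exact: measurable_mu_extE.
Qed.

Lemma planar_lebesgue_complete : measure_is_complete pleb.
Proof. exact: measure_is_complete_caratheodory. Qed.

Lemma lebesgue_null_strips (Z W : set R) : @measurable _ T0 Z ->
  @measurable _ T0 W -> leb Z = 0 -> leb W = 0 ->
  pleb.-negligible ((Z `*` setT) `|` (setT `*` W)).
Proof.
move=> mZ mW Z0 W0.
have mZT : @measurable _ (T0 * T0)%type (Z `*` setT) by exact: measurableX.
have mTW : @measurable _ (T0 * T0)%type (setT `*` W) by exact: measurableX.
have [mZT2 pZT] := planar_lebesgue_borel mZT.
have [mTW2 pTW] := planar_lebesgue_borel mTW.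
apply: negligibleU.
  apply: (iffRL (negligibleP _ mZT2)); apply: etrans pZT _.
  by rewrite product_measure1E// [X in X * _](_ : _ = 0) ?mul0e.
apply: (iffRL (negligibleP _ mTW2)); apply: etrans pTW _.
by rewrite product_measure1E// [X in _ * X](_ : _ = 0) ?mule0.
Qed.

(** The rectangle contains the product of the Borel cores of its sides, and the difference lies in
    strips over null sets; completeness of the planar measure makes that difference measurable. *)
Lemma planar_lebesgue_rectangle (A B : set R) :
  @measurable _ T1 A -> @measurable _ T1 B ->
  @measurable _ T2 (A `*` B) /\ pleb (A `*` B) = cleb A * cleb B.
Proof.
move=> mA mB.
have [X [Z [mX mZ Z0 XA AXZ]]] := completed_lebesgue_decomp mA.
have [Y [W [mY mW W0 YB BYW]]] := completed_lebesgue_decomp mB.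
have mXY : @measurable _ (T0 * T0)%type (X `*` Y) by exact: measurableX.
have [mXY2 pXY] := planar_lebesgue_borel mXY.
have nD : pleb.-negligible ((A `*` B) `\` (X `*` Y)).
  apply: negligibleS (lebesgue_null_strips mZ mW Z0 W0) => -[x y] /=.
  move=> [[/AXZ[Xx|Zx] /BYW[Yy|Wy]]] nXY; by [left|right|case: nXY].
have mD := planar_lebesgue_complete nD.
have ABE : A `*` B = (X `*` Y) `|` ((A `*` B) `\` (X `*` Y)).
  by rewrite setDUK// => -[x y] [/XA ? /YB ?].
have mAB : @measurable _ T2 (A `*` B) by rewrite ABE; exact: measurableU.
split=> //.
(* Each side has the measure of its Borel core, which reduces the claim to the rectangle of the
   cores. *)
have cE (C U N : set R) : @measurable _ T1 C -> @measurable _ T0 U ->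
    @measurable _ T0 N -> leb N = 0 -> U `<=` C -> C `<=` U `|` N ->
    cleb C = leb U.
  move=> mC mU mN N0 UC CUN.
  have [mU1 cU] := completed_lebesgue_borel mU.
  have [mN1 cN] := completed_lebesgue_borel mN.
  apply/eqP; rewrite eq_le -cU; apply/andP; split.
    apply: le_trans (le_measure cleb _ _ CUN) _; [exact/mem_set| |].
      exact/mem_set/measurableU.
    apply: le_trans (measureU2 _ _ _) _ => //.
    by rewrite [X in _ + X](_ : _ = 0) ?adde0// cN.
  by apply: le_measure => //; exact/mem_set.
rewrite (cE A X Z)// (cE B Y W)// {1}ABE measureU//; last first.
  by rewrite setIC setDKI.
rewrite [X in _ + X](_ : _ = 0); last exact: measure_negligible.
rewrite adde0; apply: etrans pXY _; exact: product_measure1E.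
Qed.

(* The completed plane has more measurable sets than the product of the
   completed lines, the space on which the library's Tonelli theorem applies. *)
Lemma measurable_id_planar : @measurable_fun _ _ T2 (T1 * T1)%type setT id.
Proof.
apply/measurable_fun_pairP; split => _ A mA; rewrite setTI.
  rewrite (_ : _ @^-1` A = A `*` setT); last first.
    by apply/seteqP; split=> -[x y] // [].
  exact: (planar_lebesgue_rectangle mA (@measurableT _ T1)).1.
rewrite (_ : _ @^-1` A = setT `*` A); last first.
  by apply/seteqP; split=> -[x y] // [].
exact: (planar_lebesgue_rectangle (@measurableT _ T1) mA).1.
Qed.

End planar.

(** * Equality in monotonicity, and halving by symmetry *)

(** Since k - g >= 0 almost everywhere, its integral is that of |k - g|, and the latter vanishes
    only if k = g almost everywhere. *)
Lemma ae_le_Rintegral_eq {R : realType} d (T : measurableType d)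
    (mu : {measure set T -> \bar R}) (D : set T) (g k : T -> R) :
  measurable D ->
  mu.-integrable D (EFin \o g) -> mu.-integrable D (EFin \o k) ->
  {ae mu, forall x, D x -> g x <= k x} ->
  \int[mu]_(x in D) g x <= \int[mu]_(x in D) k x /\
  (\int[mu]_(x in D) g x = \int[mu]_(x in D) k x <->
   {ae mu, forall x, D x -> g x = k x}).
Proof.
move=> mD ig ik gk.
have ikg := integrableB mD ik ig.
have mkg := measurable_int _ ikg.
have akg := integrable_abse ikg.
have kgE : (\int[mu]_(x in D) `|(k x - g x)%:E| =
    \int[mu]_(x in D) (k x - g x)%:E)%E.
  apply: ae_eq_integral => //; first exact: measurable_int akg.
  apply: filterS gk => x gkx Dx; rewrite gee0_abs//.
  by rewrite lee_fin subr_ge0 gkx.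
have kgR : \int[mu]_(x in D) k x - \int[mu]_(x in D) g x =
  \int[mu]_(x in D) (k x - g x) by rewrite -RintegralB.
split.
  rewrite -subr_ge0 kgR /Rintegral -kgE fine_ge0//.
  by apply: integral_ge0 => x _; rewrite lee_fin normr_ge0.
split=> [gkE|gkE].
  have : (\int[mu]_(x in D) `|(k x - g x)%:E| = 0)%E.
    rewrite kgE -(fineK (integrable_fin_num mD ikg)).
    by congr EFin; apply: etrans (esym kgR) _; rewrite gkE subrr.
  move=> /(ae_eq_integral_abs mu mD mkg); apply: filterS => x gkx Dx.
  by have /eqP := gkx Dx; rewrite /= -EFinB eqe subr_eq0 => /eqP ->//.
rewrite /Rintegral; congr fine; apply: ae_eq_integral => //.
- exact: measurable_int ig.
- exact: measurable_int ik.
- by apply: filterS gkE => x gkx Dx; rewrite /= gkx.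
Qed.

(** Tonelli in opposite orders for [L] and its complement makes the slices at [x] comparable: by the
    symmetry of [G] they agree at every y other than x, and points are null. *)
Lemma symmetric_integral_half {R : realType} d (T : measurableType d)
    (m : {sigma_finite_measure set T -> \bar R}) (L : set (T * T))
    (G : T * T -> \bar R) :
  measurable L -> (forall x : T, measurable [set x]) ->
  (forall x, m [set x] = 0%E) ->
  (forall x y, L (x, y) \/ L (y, x)) ->
  (forall x y, L (x, y) -> L (y, x) -> x = y) ->
  measurable_fun setT G -> (forall z, 0 <= G z)%E ->
  (forall x y, G (x, y) = G (y, x)) ->
  (\int[m \x m]_z G z =
   \int[m \x m]_z (G \_ L) z + \int[m \x m]_z (G \_ L) z)%E.
Proof.
move=> mL m1 m10 Ltot Lanti mG G0 GC.
have patch0 (A : set (T * T)) z : (0 <= (G \_ A) z)%E.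
  by rewrite patchE; case: ifP.
have mGL (A : set (T * T)) : measurable A -> measurable_fun setT (G \_ A).
  move=> mA; apply: (iffLR (measurable_restrictT _ mA)).
  exact: measurable_funTS.
have mLC : measurable (~` L) by exact: measurableC.
transitivity (\int[m \x m]_(z in L) G z + \int[m \x m]_(z in ~` L) G z)%E.
  rewrite -ge0_integral_setU ?setUv//.
  exact/disj_setPCl.
rewrite integral_mkcond [in X in (_ + X)%E]integral_mkcond; congr (_ + _)%E.
rewrite fubini_tonelli1//; last exact: mGL.
rewrite fubini_tonelli2//; last exact: mGL.
apply: eq_integral => x _; rewrite /fubini_F /fubini_G.
have mLC1 := measurable_fun_pair1 x (mGL _ mLC).
have mL1 := measurable_fun_pair2 x (mGL _ mL).
rewrite (@ge0_negligible_integral _ _ _ m _ _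
  (fun y => (G \_ (~` L)) (y, x)) (m1 x) measurableT _ _ (m10 x))//.
rewrite [RHS](@ge0_negligible_integral _ _ _ m _ _
  (fun y => (G \_ L) (x, y)) (m1 x) measurableT _ _ (m10 x))//.
apply: eq_integral => y /set_mem[_ /= yx].
rewrite !patchE GC; have [Lxy|Lyx] := Ltot x y.
  rewrite [in RHS]mem_set// mem_set// => Lyx; exact/yx/esym/Lanti.
by rewrite memNset// memNset// => Lxy; exact/yx/esym/Lanti.
Qed.

(** * The Schwarz gap and its integral over the square *)

Section schwarz_gap.
Context {R : realType} {c : scalar_kind} {H : normedModType (scalars R c)}.
Variable dot : {dot H for scalar_conj}.
Hypothesis dot_norm : forall x : H, dot x x = `|x| ^+ 2.
Context d (T : measurableType d).
Implicit Types (D : set T) (f : T -> H).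

Definition schwarz_gap f (z : T * T) : R :=
  rnorm (f z.1) * rnorm (f z.2) - rdot dot (f z.1) (f z.2).

Lemma schwarz_gap_ge0 f z : 0 <= schwarz_gap f z.
Proof. by rewrite subr_ge0 ler_rdot. Qed.

Lemma schwarz_gapC f x y : schwarz_gap f (x, y) = schwarz_gap f (y, x).
Proof. by rewrite /schwarz_gap/= mulrC rdotC. Qed.

Variable m : {sigma_finite_measure set T -> \bar R}.
Variables (D : set T) (f : T -> H) (s : nat -> T -> H).
Hypotheses (mD : measurable D) (Doo : (m D < +oo)%E).
Hypothesis ss : forall n, simple_on m D (s n).
Hypothesis sf : forall t, D t -> s n t @[n --> \oo] --> f t.

Lemma measurable_schwarz_gap : measurable_fun (D `*` D) (schwarz_gap f).
Proof.
have m1 : measurable_fun (D `*` D) (fun z : T * T => rnorm (f z.1)).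
  apply: (measurable_fun_cvg (h := fun n z => rnorm (s n z.1))) => [n|z [Dz _]].
    exact: simple_on_measurable_funX (fun x _ => rnorm x) (ss n) (ss n).
  exact: cvg_rnorm_approx sf _ Dz.
have m2 : measurable_fun (D `*` D) (fun z : T * T => rnorm (f z.2)).
  apply: (measurable_fun_cvg (h := fun n z => rnorm (s n z.2))) => [n|z [_ Dz]].
    exact: simple_on_measurable_funX (fun _ x => rnorm x) (ss n) (ss n).
  exact: cvg_rnorm_approx sf _ Dz.
apply: measurable_funB; first exact: measurable_funM.
apply: (measurable_fun_cvg (h := fun n z => rdot dot (s n z.1) (s n z.2))).
  by move=> n; exact: simple_on_measurable_funX (rdot dot) (ss n) (ss n).
by move=> z [Dz1 Dz2]; apply: cvg_rdot => //; exact: sf.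
Qed.

Hypothesis intsf :
  (\int[m]_(t in D) (rnorm (f t - s n t))%:E @[n --> \oo] --> 0)%E.
Variable V : nat -> H.
Hypothesis VE :
  forall n x, rdot dot (V n) x = \int[m]_(t in D) rdot dot (s n t) x.

(** The gap is nonnegative, so Tonelli applies to it as a whole. The inner integral at x in [D] is
    ||f x|| I - Re <f x, v>, and the weak characterization of [v] used once more yields I^2 - Re <v,
    v>. *)
Lemma integral_schwarz_gap v : V n @[n --> \oo] --> v ->
  (\int[m \x m]_z ((schwarz_gap f \_ (D `*` D)) z)%:E =
   ((\int[m]_(t in D) rnorm (f t)) ^+ 2 - rnorm v ^+ 2)%:E)%E.
Proof.
move=> Vv.
pose I := \int[m]_(t in D) rnorm (f t).
have imf : m.-integrable D (EFin \o (fun t => rnorm (f t))).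
  exact: integrable_rnorm_limit intsf.
have irf x : m.-integrable D (EFin \o (fun t => rdot dot (f t) x)).
  exact: (integrable_rdot_limit mD Doo ss sf intsf dot_norm x).
have rvE x : rdot dot v x = \int[m]_(t in D) rdot dot (f t) x.
  exact: rdot_weak_integral Vv.
have mDD : measurable (D `*` D) by exact: measurableX.
rewrite fubini_tonelli1; first last.
- move=> z; rewrite lee_fin patchE; case: ifP => // _.
  exact: schwarz_gap_ge0.
- apply/measurable_EFinP; apply: (iffLR (measurable_restrictT _ mDD)).
  exact: measurable_schwarz_gap.
have FE x : fubini_F m (fun z => ((schwarz_gap f \_ (D `*` D)) z)%:E) x =
    (((fun x => rnorm (f x) * I - rdot dot (f x) v) \_ D) x)%:E.
  rewrite /fubini_F patchE; case: ifPn => [/set_mem Dx|/negP xD]; last first.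
    apply: integral0_eq => y _; rewrite patchE memNset// => -[/= Dx _].
    by apply: xD; exact: mem_set.
  transitivity (\int[m]_(y in D) (schwarz_gap f (x, y))%:E)%E.
    rewrite [RHS]integral_mkcond; apply: eq_integral => y _; rewrite !patchE.
    have [yD|yD] := boolP (y \in D).
      by rewrite mem_set//; split=> //; exact: set_mem.
    by rewrite memNset// => -[_ /= Dy]; move/negP: yD; apply; exact: mem_set.
  have i1 : m.-integrable D (EFin \o (fun y => rnorm (f x) * rnorm (f y))).
    exact: (integrableZl mD (rnorm (f x)) imf).
  have i2 : m.-integrable D (EFin \o (fun y => rdot dot (f x) (f y))).
    by under eq_fun do rewrite rdotC; exact: irf.
  rewrite -(fineK (integrable_fin_num mD (integrableB mD i1 i2))).
  congr EFin; apply: etrans (RintegralB mD i1 i2) _.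
  rewrite RintegralZl// rdotC rvE; congr (_ - _).
  by apply: eq_Rintegral => y _; rewrite rdotC.
transitivity (\int[m]_(x in D) (rnorm (f x) * I - rdot dot (f x) v)%:E)%E.
  rewrite [RHS]integral_mkcond; apply: eq_integral => x _.
  by rewrite FE restrict_EFin.
have i1 : m.-integrable D (EFin \o (fun x => rnorm (f x) * I)).
  exact: (integrableZr mD I imf).
rewrite -(fineK (integrable_fin_num mD (integrableB mD i1 (irf v)))).
congr EFin; apply: etrans (RintegralB mD i1 (irf v)) _.
by rewrite RintegralZr// -rvE rdotxx// expr2.
Qed.

End schwarz_gap.

(** * The Bochner integral after removal of a null set *)

(** Measurability of [g] is given off [N] only; completeness extends it to [D], where [g] agrees
    almost everywhere with its restriction extended by zero. *)
Lemma complete_ge0_integral_setD {R : realType} d (T : measurableType d)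
    (mu : {measure set T -> \bar R}) (D N : set T) (g : T -> \bar R) :
  measure_is_complete mu -> measurable D -> measurable N -> mu N = 0%E ->
  measurable_fun (D `\` N) g -> (forall t, D t -> 0 <= g t)%E ->
  (\int[mu]_(t in D) g t = \int[mu]_(t in D `\` N) g t)%E.
Proof.
move=> cmu mD mN N0 mg g0.
have mDN : measurable (D `\` N) by exact: measurableD.
apply: ge0_negligible_integral => //.
apply: (@ae_measurable_fun _ _ _ _ cmu D (g \_ (D `\` N))).
  exists N; split=> // t /= /not_implyP[Dt].
  by apply: contra_notP => Nt; rewrite patchE mem_set.
apply: (iffLR (measurable_restrict _ mDN mD)).
by apply: measurable_funS mg => //; exact: subIsetr.
Qed.

Section bochner.
Context {R : realType} {c : scalar_kind}.
Context d (T : measurableType d) (mu : {measure set T -> \bar R}).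
Hypothesis cmu : measure_is_complete mu.
Variable D : set T.
Hypotheses (mD : measurable D) (Doo : (mu D < +oo)%E).

Section restrict.
Context {H : normedModType (scalars R c)}.
Variable dot : {dot H for scalar_conj}.
Variables (f : T -> H) (s : nat -> T -> H).
Hypothesis approx : bochner_approx mu D f s.

(** Discards a null set containing the points where convergence fails, so that the results on
    everywhere convergent sequences apply to the rest of [D]. *)
Lemma bochner_approx_strong : exists N : set T,
  [/\ measurable N, mu N = 0%E,
      (forall t, (D `\` N) t -> s n t @[n --> \oo] --> f t),
      (forall n, simple_on mu (D `\` N) (s n)) &
      (\int[mu]_(t in D `\` N) (rnorm (f t - s n t))%:E @[n --> \oo] --> 0)%E].
Proof.
have [ss [N [mN N0 fN]] intsf] := approx.
have mDN : measurable (D `\` N) by exact: measurableD.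
have sf t : (D `\` N) t -> s n t @[n --> \oo] --> f t.
  by move=> [Dt Nt]; apply: contrapT => nsf; apply: Nt; apply: fN => /= /(_ Dt).
have ssN n : simple_on mu (D `\` N) (s n).
  by apply: simple_onS (ss n) => //; exact: subDsetl.
exists N; split=> //.
rewrite (_ : (fun n => _) =
    fun n => \int[mu]_(t in D) (rnorm (f t - s n t))%:E)%E//.
apply/funext => n; apply/esym/complete_ge0_integral_setD => //.
  exact/measurable_EFinP/(measurable_rnorm_limitB ssN sf).
by move=> t _; rewrite lee_fin rnorm_ge0.
Qed.

(** Supplies the hypothesis [VE]: the simple integrals over all of [D] are weak integrals over the
    reduced domain. *)
Lemma rdot_simple_integral_setD N n x : measurable N -> mu N = 0%E ->
  rdot dot (simple_integral mu D (s n)) x =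
  \int[mu]_(t in D `\` N) rdot dot (s n t) x.
Proof.
move=> mN N0; have [ss _ _] := approx.
rewrite rdot_simple_integral//; congr fine; apply: negligible_integral => //.
by have [] := simple_on_integral (rdot dot ^~ x) mD Doo (ss n).
Qed.

End restrict.

(* The completeness of [H] makes the set under [get] in [bochner_integral]
   nonempty; no uniqueness of the limit is needed to use its value. *)
Lemma bochner_integral_approx {H : completeNormedModType (scalars R c)}
    (dot : {dot H for scalar_conj}) (f : T -> H) :
  (forall x : H, dot x x = `|x| ^+ 2) ->
  bochner_integrable mu D f ->
  exists s : nat -> T -> H, bochner_approx mu D f s /\
    simple_integral mu D (s n) @[n --> \oo] --> bochner_integral mu D f.
Proof.
move=> dot_norm [s approx]; rewrite /bochner_integral.
set P := (P in get P); suff : P (get P) by [].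
have [N [mN N0 sf ss intsf]] := bochner_approx_strong approx.
have mDN : measurable (D `\` N) by exact: measurableD.
have DNoo : (mu (D `\` N) < +oo)%E.
  apply: le_lt_trans Doo.
  by apply: le_measure; [exact/mem_set|exact/mem_set|exact: subDsetl].
have VE n x := rdot_simple_integral_setD dot approx n x mN N0.
have /cvg_ex[v Vv] : cvg (simple_integral mu D (s n) @[n --> \oo]).
  apply: (rnorm_cauchy_cvg (e := fun n =>
      \int[mu]_(t in D `\` N) rnorm (f t - s n t))) => [n p|].
    exact: (weak_integral_cauchy mDN DNoo ss sf intsf dot_norm VE).
  exact: cvg_approx_error intsf.
by apply: (getPex (ex_intro _ v _)); exists s.
Qed.

End bochner.

(** * The inequality on half of the square *)

(* [phi : U -> T * T] stands for the identity map from the completed plane to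
   the product of two completed lines, and [L] for the half-plane [t <= s]. *)
Section half_square.
Context {R : realType} {c : scalar_kind}.
Context {H : completeNormedModType (scalars R c)}.
Variable dot : {dot H for scalar_conj}.
Hypothesis dot_norm : forall x : H, dot x x = `|x| ^+ 2.
Context d (T : measurableType d) d' (U : measurableType d').
Variables (m : {sigma_finite_measure set T -> \bar R}).
Hypothesis cm : measure_is_complete m.
Hypothesis m1 : forall x : T, measurable [set x].
Hypothesis m10 : forall x : T, m [set x] = 0%E.
Variables (n : {measure set U -> \bar R}) (phi : U -> T * T).
Hypothesis mphi : measurable_fun setT phi.
Hypothesis nE : forall A B : set T, measurable A -> measurable B ->
  n (phi @^-1` (A `*` B)) = (m A * m B)%E.
Variable L : set (T * T).
Hypothesis mL : measurable L.
Hypothesis Ltot : forall x y, L (x, y) \/ L (y, x).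
Hypothesis Lanti : forall x y, L (x, y) -> L (y, x) -> x = y.
Variable D : set T.
Hypotheses (mD : measurable D) (Doo : (m D < +oo)%E).
Variable f : T -> H.
Hypothesis intf : bochner_integrable m D f.

Let I := \int[m]_(t in D) rnorm (f t).
Let J := rnorm (bochner_integral m D f).
Let Delta := phi @^-1` (L `&` D `*` D).

Let measurable_Delta : measurable Delta.
Proof.
rewrite -[X in measurable X]setTI; apply: mphi => //.
by apply: measurableI => //; exact: measurableX.
Qed.

(** Measurability of the gap is available only away from the strips over a null set [N]; its
    integral is therefore taken through a representative [g] that is zero there. *)
Lemma schwarz_gap_half : exists g : U -> R,
  [/\ n.-integrable Delta (EFin \o g),
      2 * \int[n]_(z in Delta) g z = I ^+ 2 - J ^+ 2 &
      {ae n, forall z, Delta z -> g z = schwarz_gap dot f (phi z)}].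
Proof.
have [s [approx Vv]] := bochner_integral_approx cm mD Doo dot_norm intf.
have [N [mN N0 sf ss intsf]] := bochner_approx_strong cm mD approx.
set E := D `\` N in sf ss intsf.
have mE : measurable E by exact: measurableD.
have ED : E `<=` D by exact: subDsetl.
have Eoo : (m E < +oo)%E.
  by apply: le_lt_trans Doo; apply: le_measure; [exact/mem_set|exact/mem_set|].
have VE k x := rdot_simple_integral_setD mD Doo dot approx k x mN N0.
have IE : I = \int[m]_(t in E) rnorm (f t).
  congr fine; apply: complete_ge0_integral_setD => //.
    exact/measurable_EFinP/(measurable_rnorm_limit ss sf).
  by move=> t _; rewrite lee_fin rnorm_ge0.
have mEE : measurable (E `*` E) by exact: measurableX.
(* Extension by zero keeps the symmetry and gives measurability on the whole product, as the halving
   requires. *)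
pose G := schwarz_gap dot f \_ (E `*` E).
have mG : measurable_fun setT G.
  apply: (iffLR (measurable_restrictT _ mEE)).
  exact: measurable_schwarz_gap ss sf.
have G0 z : 0 <= G z.
  by rewrite /G patchE; case: ifP => // _; exact: schwarz_gap_ge0.
have GC x y : G (x, y) = G (y, x).
  rewrite /G !patchE schwarz_gapC; congr (if _ then _ else _).
  by apply/idP/idP => /set_mem[/= ? ?]; exact/mem_set.
have GI := integral_schwarz_gap dot_norm mE Eoo ss sf intsf VE Vv.
have mEG : measurable_fun setT (EFin \o G) by exact/measurable_EFinP.
have mGL : measurable_fun setT ((EFin \o G) \_ L).
  by apply: (iffLR (measurable_restrictT _ mL)); exact: measurable_funTS.
have GL0 z : (0 <= ((EFin \o G) \_ L) z)%E.
  by rewrite patchE; case: ifP => // _; rewrite lee_fin.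
(* The value over the square is twice the integral over [L], which is then pulled back along
   [phi]. *)
have := symmetric_integral_half mL m1 m10 Ltot Lanti mEG _ _.
move=> /(_ (fun z => G0 z) (fun x y => congr1 EFin (GC x y))).
rewrite [X in X = _ -> _]GI -IE -(product_measure_integral mphi nE mGL GL0).
rewrite -/I -/J.
pose g z := (G \_ L) (phi z).
have gE z : ((EFin \o G) \_ L) (phi z) = (g z)%:E by rewrite restrict_EFin.
under eq_integral do rewrite gE.
move=> IJ.
(* [g] vanishes outside [Delta], because [E] lies in [D]. *)
have gT : (\int[n]_z (g z)%:E = \int[n]_(z in Delta) (g z)%:E)%E.
  rewrite [RHS]integral_mkcond; apply: eq_integral => z _.
  rewrite patchE; case: ifPn => // /negP Dz; rewrite /g patchE.
  case: ifPn => // /set_mem Lz; rewrite /G patchE; case: ifPn => // /set_mem.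
  by case=> /ED D1 /ED D2; exfalso; apply: Dz; apply/mem_set; split.
have g0 z : 0 <= g z by rewrite /g patchE; case: ifP => // _; exact: G0.
have mg : measurable_fun Delta (EFin \o g).
  rewrite (_ : EFin \o g = ((EFin \o G) \_ L) \o phi).
    by apply: measurable_funTS; exact: measurableT_comp.
  by apply/funext => z; rewrite /= gE.
set h := (\int[n]_(z in Delta) (g z)%:E)%E in gT.
rewrite gT in IJ.
(* [IJ] equates [h + h] with a real number; the integrability of [g] comes from this. *)
have hfin : h \is a fin_num by move: IJ; case: (h).
have ig : n.-integrable Delta (EFin \o g).
  apply/integrableP; split=> //.
  under eq_integral do rewrite gee0_abs ?lee_fin//.
  rewrite -/h -ge0_fin_numE//; apply: integral_ge0 => z _.
  by rewrite lee_fin.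
exists g; split=> //.
  rewrite /Rintegral -/h mulr_natl mulr2n; apply: EFin_inj.
  by rewrite EFinD fineK// IJ.
(* On [Delta], [g] can differ from the gap only where a coordinate lies in [N]; these strips are
   null by [nE]. *)
pose Z := phi @^-1` (N `*` setT) `|` phi @^-1` (setT `*` N).
have negZ : n.-negligible Z.
  have mNT : measurable (N `*` [set: T]) by exact: measurableX.
  have mTN : measurable ([set: T] `*` N) by exact: measurableX.
  have mpre (X : set (T * T)) : measurable X -> measurable (phi @^-1` X).
    by move=> mX; rewrite -[X in measurable X]setTI; exact: mphi.
  apply: negligibleU.
    apply: (iffRL (negligibleP n (mpre _ mNT))).
    by apply: etrans (nE mN measurableT) _; rewrite N0 mul0e.
  apply: (iffRL (negligibleP n (mpre _ mTN))).
  by apply: etrans (nE measurableT mN) _; rewrite N0 mule0.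
apply: negligibleS negZ => z /= /not_implyP[[Lz [Dz1 Dz2]] gz].
apply: contrapT => /not_orP[Nz1 Nz2]; apply: gz.
rewrite /g patchE mem_set// /G patchE mem_set//.
by split; split=> // Nz; [apply: Nz1|apply: Nz2].
Qed.

Variable k : U -> R.
Hypothesis intk : n.-integrable Delta (EFin \o k).
Hypothesis dom :
  {ae n, forall z, Delta z -> schwarz_gap dot f (phi z) <= k z}.

(** As I^2 - J^2 is twice the integral of the representative [g], both claims are monotonicity of
    the integral, with its equality case, for [g] and [k]. *)
Lemma half_square_integral :
  I ^+ 2 <= J ^+ 2 + 2 * \int[n]_(z in Delta) k z /\
  (I ^+ 2 = J ^+ 2 + 2 * \int[n]_(z in Delta) k z <->
   {ae n, forall z, Delta z -> schwarz_gap dot f (phi z) = k z}).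
Proof.
have [g [ig gE gae]] := schwarz_gap_half.
have gk : {ae n, forall z, Delta z -> g z <= k z}.
  by apply: filterS2 gae dom => z gz kz Dz; rewrite gz// kz.
have [le_gk eq_gk] := ae_le_Rintegral_eq measurable_Delta ig intk gk.
split; first by lra.
apply: iff_trans (iff_trans eq_gk _).
  by split; lra.
by split; apply: filterS2 gae => z gz kz Dz; [rewrite -gz// kz|rewrite gz// kz].
Qed.

End half_square.

(** * The completed line, the triangle and the conclusion *)

Section completed_line.
Context {R : realType}.

Let T0 : measurableType _ := measurableTypeR R.
Let T1 : measurableType _ := caratheodory_type (@wlength R idfun)^*%mu.

Lemma completed_lebesgue_set1 (x : R) :
  @measurable _ T1 [set x] /\ @completed_lebesgue_measure R [set x] = 0%E.
Proof.
have m1 : @measurable _ T0 [set x] by exact: measurable_set1.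
have [? xE] := completed_lebesgue_borel m1.
by split => //; apply: etrans xE _; exact: lebesgue_measure_set1.
Qed.

Lemma completed_lebesgue_itv_lty (a b : R) :
  @measurable _ T1 `[a, b]%classic /\
  (@completed_lebesgue_measure R `[a, b]%classic < +oo)%E.
Proof.
have mab : @measurable _ T0 `[a, b]%classic by exact: measurable_itv.
have [? abE] := completed_lebesgue_borel mab.
split => //; apply: (@le_lt_trans _ _ (@lebesgue_measure R `[a, b]%classic)).
  by rewrite -abE.
by rewrite lebesgue_measure_itv/=; case: ifP => // _; rewrite -EFinB ltry.
Qed.

Lemma measurable_completed_le :
  @measurable _ (T1 * T1)%type [set z : R * R | z.1 <= z.2].
Proof.
(* Through the identity from the completed line to the Borel line, the coordinates become real
   measurable functions, which can be compared. *)
have m01 : @measurable_fun _ _ T1 T0 setT id.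
  by move=> _ Y mY; rewrite setTI; exact: (completed_lebesgue_borel mY).1.
have m1 : @measurable_fun _ _ (T1 * T1)%type T0 setT fst.
  exact: measurableT_comp m01 (@measurable_fst _ _ T1 T1).
have m2 : @measurable_fun _ _ (T1 * T1)%type T0 setT snd.
  exact: measurableT_comp m01 (@measurable_snd _ _ T1 T1).
have := @measurable_fun_ler _ (T1 * T1)%type R setT _ _ m1 m2 measurableT
  [set true].
rewrite setTI; exact.
Qed.

End completed_line.

Lemma triangleE {R : realType} (a b : R) :
  triangle a b = [set z | z.1 <= z.2] `&` `[a, b] `*` `[a, b].
Proof.
apply/seteqP; split=> [[x y]|[x y]] /=; rewrite /triangle/= !in_itv/=.
  move=> [ax xy yb]; split=> //; split; apply/andP; split=> //.
  - exact: le_trans yb.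
  - exact: le_trans xy.
by move=> [xy [/andP[ax _] /andP[_ yb]]].
Qed.

Unset Implicit Arguments.

Theorem lemma1 (R : realType) (c : scalar_kind)
    (H : completeNormedModType (scalars R c)) (dot : {dot H for scalar_conj})
    (dot_norm : forall x : H, dot x x = `|x| ^+ 2)
    (a b : R) (leab : a <= b) (f : R -> H) (k : R * R -> R)
    (intf : bochner_integrable completed_lebesgue_measure `[a, b] f)
    (intk : planar_lebesgue_measure.-integrable (triangle a b) (EFin \o k))
    (dom : {ae planar_lebesgue_measure, forall z : R * R, triangle a b z ->
       rnorm (f z.1) * rnorm (f z.2) - scalar_Re (dot (f z.1) (f z.2)) <= k z})
    :
  let I := \int[completed_lebesgue_measure]_(t in `[a, b]) rnorm (f t) in
  let J := rnorm (bochner_integral completed_lebesgue_measure `[a, b] f) in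
  let K := \int[planar_lebesgue_measure]_(z in triangle a b) k z in
  I ^+ 2 <= J ^+ 2 + 2 * K /\
  (I ^+ 2 = J ^+ 2 + 2 * K <->
   {ae planar_lebesgue_measure, forall z : R * R, triangle a b z ->
      rnorm (f z.1) * rnorm (f z.2) - scalar_Re (dot (f z.1) (f z.2)) = k z}).
Proof.
have [mD Doo] := completed_lebesgue_itv_lty a b.
rewrite triangleE in intk dom *.
(* Here [phi] is the identity, so the preimage [Delta] and the gap unfold to the triangle and to the
   expression in the statement. *)
exact: (half_square_integral dot_norm
  (@completed_lebesgue_measure_is_complete R)
  (fun x => (completed_lebesgue_set1 x).1)
  (fun x => (completed_lebesgue_set1 x).2)
  (@measurable_id_planar R)
  (fun A B mA mB => (planar_lebesgue_rectangle mA mB).2)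
  measurable_completed_le (fun x y => orP (le_total x y))
  (fun x y xy yx => le_anti (introT andP (conj xy yx)))
  mD Doo intf intk dom).
Qed.
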